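(* Let $X$ be a compact metric space, let $\phi$ be a continuous flow on $X$, and let $\Lambda\subset X$ be a compact, invariant and non-trivial chain-transitive subset. If $\Lambda$ is not an irreducible almost heteroclinic set and $\Lambda$ has the local standard shadowing property, then $\phi$ has positive topological entropy.
   Context: $(X,d)$ is a compact metric space, $\phi$ a continuous flow on $X$, $\mathcal O(x)$ the orbit of $x$, $\alpha(x),\omega(x)$ its limit sets. $\operatorname{Sing}(\phi)$ is the set of points fixed by all $\phi_t$; other points are regular. The topological entropy of $\phi$ is that of the time-one map $\phi_1$. Pseudo-orbits and tracing. For $\delta,T>0$, a $\delta$-$T$-pseudo-orbit is a sequence $P=(x_i,t_i)_i$ indexed by an interval of integers (all of $\mathbb Z$ unless said to be finite) with $t_i\ge T$ and $d(\phi_{t_i}(x_i),x_{i+1})\le\delta$ for all consecutive indices $i,i+1$. For a bi-infinite one put $\mathcal P(P)=\bigcup_{i\in\mathbb Z}\phi_{[0,t_i]}(x_i)$, $S_0=0$, $S_i=\sum_{n=0}^{i-1}t_n$ for $i>0$, $S_i=-\sum_{n=1}^{|i|}t_{-n}$ for $i<0$. For $\varepsilon>0$, $\mathrm{Rep}(\varepsilon)$ is the set of increasing homeomorphisms $h:\mathbb R\to\mathbb R$ with $h(0)=0$ and $|\frac{h(t)-h(s)}{t-s}-1|\le\varepsilon$ for all $t\ne s$. $P$ is strongly $\varepsilon$-traced by $x\in X$ if there is $h\in\mathrm{Rep}(\varepsilon)$ with $d(\phi_{t-S_i}(x_i),\phi_{h(t)}(x))\le\varepsilon$ for all $i\in\mathbb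 Z$, $t\in[S_i,S_{i+1}]$. Local standard shadowing property of a compact set $\Lambda$: for every $\varepsilon>0$ and $T>0$ there are a neighborhood $U$ of $\Lambda$ and $\delta>0$ such that every $\delta$-$T$-pseudo-orbit $P$ with $\mathcal P(P)\subset U$ is strongly $\varepsilon$-traced by some point of $X$. Chain-transitivity: a compact invariant set $K$ is chain-transitive if for all $x,y\in K$ and every $\delta>0$ there are $N\ge1$ and a finite $\delta$-$1$-pseudo-orbit $(x_i,t_i)_{i=0}^N$ contained in $K$ with $x_0=x$, $x_N=y$. A compact invariant set is non-trivial if it is not a single orbit and is not contained in $\operatorname{Sing}(\phi)$. The orbit $\mathcal O(x)$ of a regular point is a homoclinic loop if $\overline{\mathcal O(x)}=\mathcal O(x)\cup\{\sigma\}$ for some $\sigma\in\operatorname{Sing}(\phi)$; it is a heteroclinic connection if it is not a homoclinic loop and $\alpha(x)\cup\omega(x)\subset\operatorname{Sing}(\phi)$. A compact, invariant, chain-transitive set $\Lambda$ is almost heteroclinic if every regular point of $\Lambda$ whose orbit is not dense in $\Lambda$ lies on a heteroclinic connection. It is irreducible if it contains no proper non-trivial almost heteroclinic set. *)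

(* Defs.v *)
From HB Require Import structures.
From mathcomp Require Import all_boot all_order all_algebra finmap.
From mathcomp Require Import all_classical all_reals all_analysis.

Set Implicit Arguments.
Unset Strict Implicit.
Unset Printing Implicit Defensive.

Import Order.TTheory GRing.Theory Num.Theory.
Import numFieldNormedType.Exports.

Local Open Scope classical_set_scope.
Local Open Scope ring_scope.

Section Entropy.
Context {R : realType} {X : metricType R}.

Definition separated (f : X -> X) (n : nat) (e : R) (A : {fset X}) : Prop :=
  forall x y, x \in A -> y \in A -> x <> y ->
    exists2 k, (k < n)%N & e < mdist (iter k f x) (iter k f y).

Definition separated_number (f : X -> X) (n : nat) (e : R) : \bar R :=
  ereal_sup [set (#|` A|%:R)%:E | A in [set A | separated f n e A]].

Definition entropy_at_scale (f : X -> X) (e : R) : \bar R :=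
  limn_esup (fun n => (n%:R^-1)%:E * lne (separated_number f n e))%E.

Lemma entropy_at_scale_nonincreasing (f : X -> X) (e1 e2 : R) :
  e1 <= e2 -> (entropy_at_scale f e2 <= entropy_at_scale f e1)%E.
Proof.
move=> e12.
have sep0 n e : (0 <= separated_number f n e)%E.
  by apply: ereal_sup_ubound; exists fset0 => //=; rewrite cardfs0.
have sep n : (separated_number f n e2 <= separated_number f n e1)%E.
  apply: ereal_sup_le => _ [A sA <-]; exists A => //.
  move=> x y xA yA xy; have [k kn lk] := sA x y xA yA xy.
  by exists k => //; exact: le_lt_trans lk.
rewrite /entropy_at_scale /limn_esup.
apply: le_ereal_inf_tmp => _ [V nV <-].
apply: le_trans (ereal_inf_lbound _) _; first by exists V; [exact: nV|reflexivity].
apply: ge_ereal_sup => _ [n Vn <-].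
apply: le_trans (ereal_sup_ubound _); last by exists n.
apply: lee_wpmul2l; first by rewrite lee_fin invr_ge0.
by rewrite lee_lne// in_itv/= ?sep0 leey.
Qed.

Lemma is_cvg_entropy_at_scale (f : X -> X) :
  cvg (entropy_at_scale f e @[e --> 0^'+]).
Proof.
apply: nonincreasing_at_right_is_cvge; near=> x.
by move=> a b _ _ ab; exact: entropy_at_scale_nonincreasing.
Unshelve. all: by end_near. Qed.

(* Bowen's definition; by [is_cvg_entropy_at_scale] the limit exists. *)
Definition topological_entropy (f : X -> X) : \bar R :=
  lim (entropy_at_scale f e @[e --> 0^'+]).

End Entropy.

Section Flows.
Context {R : realType} {X : metricType R}.
Implicit Types (phi : R -> X -> X) (K L : set X) (x y : X).

Definition continuous_flow phi : Prop :=
  [/\ continuous (fun p : R * X => phi p.1 p.2),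
      forall x, phi 0 x = x &
      forall s t x, phi (s + t) x = phi s (phi t x)].

Definition flow_entropy phi : \bar R := topological_entropy (phi 1).

Definition flow_orbit phi x : set X := range (phi ^~ x).

Definition omega_limit phi x : set X := cluster (phi ^~ x @ +oo).

Definition alpha_limit phi x : set X := cluster (phi ^~ x @ -oo).

Definition Sing phi : set X := [set x | forall t, phi t x = x].

Definition invariant_set phi K : Prop := forall t, phi t @` K = K.

Definition nontrivial phi K : Prop :=
  (~ exists x, K = flow_orbit phi x) /\ ~ (K `<=` Sing phi).

(* The pseudo-orbit is the restriction to [I] of the total sequence
   [(x i, t i)]; values outside [I] are irrelevant. *)
Definition pseudo_orbit phi (d T : R) (I : interval int)
    (x : int -> X) (t : int -> R) : Prop :=
  (forall i, i \in I -> T <= t i) /\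
  (forall i, i \in I -> i + 1 \in I ->
    mdist (phi (t i) (x i)) (x (i + 1)) <= d).

Definition pseudo_orbit_support phi (x : int -> X) (t : int -> R) : set X :=
  \bigcup_i [set phi s (x i) | s in `[0, t i]].

(* [Negz n] is the integer [- n.+1]. *)
Definition switching_time (t : int -> R) (i : int) : R :=
  match i with
  | Posz n => \sum_(0 <= k < n) t k%:Z
  | Negz n => - \sum_(1 <= k < n.+2) t (- k%:Z)
  end.

Definition Rep (e : R) : set (R -> R) := [set h |
  [/\ {homo h : s t / s < t},
      continuous h,
      exists g : R -> R, [/\ cancel h g, cancel g h & continuous g],
      h 0 = 0 &
      forall s t, t != s -> `|(h t - h s) / (t - s) - 1| <= e]].

Definition strongly_traced phi (e : R) (x : int -> X) (t : int -> R) (y : X)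
    : Prop :=
  exists2 h, Rep e h &
    forall i s,
      switching_time t i <= s <= switching_time t (i + 1) ->
      mdist (phi (s - switching_time t i) (x i)) (phi (h s) y) <= e.

Definition local_standard_shadowing phi L : Prop :=
  forall e T : R, 0 < e -> 0 < T ->
  exists U : set X, exists d : R, [/\ set_nbhs L U, 0 < d &
    forall (x : int -> X) (t : int -> R),
      pseudo_orbit phi d T `]-oo, +oo[ x t ->
      pseudo_orbit_support phi x t `<=` U ->
      exists y, strongly_traced phi e x t y].

Definition chain_transitive phi K : Prop :=
  forall x y, K x -> K y -> forall d : R, 0 < d ->
  exists N : nat, exists z : int -> X, exists t : int -> R,
    [/\ (1 <= N)%N,
        pseudo_orbit phi d 1 `[0, N%:Z] z t,
        forall i, i \in `[0, N%:Z] -> K (z i),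
        z 0 = x &
        z N%:Z = y].

Definition homoclinic_loop phi x : Prop :=
  ~ Sing phi x /\
  exists2 s, Sing phi s & closure (flow_orbit phi x) = flow_orbit phi x `|` [set s].

Definition heteroclinic_connection phi x : Prop :=
  [/\ ~ Sing phi x, ~ homoclinic_loop phi x &
      alpha_limit phi x `|` omega_limit phi x `<=` Sing phi].

Definition almost_heteroclinic phi L : Prop :=
  [/\ compact L, invariant_set phi L, chain_transitive phi L &
      forall x, L x -> ~ Sing phi x -> ~ (L `<=` closure (flow_orbit phi x)) ->
        heteroclinic_connection phi x].

Definition irreducible phi L : Prop :=
  ~ exists K, [/\ K `<` L, nontrivial phi K & almost_heteroclinic phi K].

End Flows.

(* Main.v *)
Require Import Defs.
From mathcomp Require Import all_boot all_order all_algebra finmap.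
From mathcomp Require Import all_classical all_reals all_analysis.
From mathcomp Require Import lra.
Import Order.TTheory GRing.Theory Num.Theory.
Import numFieldNormedType.Exports.
Local Open Scope classical_set_scope.
Local Open Scope ring_scope.

Set Implicit Arguments.
Unset Strict Implicit.
Unset Printing Implicit Defensive.

(** If [Lambda] is not almost heteroclinic, some orbit is not dense in it; if it
is reducible, no orbit of a proper invariant closed subset is dense in it.
Either way there are [x] and [q] in [Lambda] with [q] outside the closure of the
orbit of [x], and no other property of heteroclinic connections is needed. For
every [d] some point [p] of that orbit returns [d]-close to itself, and
chain-transitivity gives a loop based at [p] through [q]. Concatenating this
loop with stays of two very different lengths near the orbit of [x] codes any
binary word by a pseudo-orbit. Points tracing the codes of distinct words are
separated: along the common prefix the two tracing points are synchronized, up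
to twice the length of the loop, by their visits near [q], so at the first
discrepancy one of them visits [q] while the other stays near the orbit of [x].
Hence the number of separated points grows exponentially. *)

(** * Reparametrizations and decoding of words *)

Lemma Rep_bounds (R : realType) (e : R) (h : R -> R) (s t : R) :
  Rep e h -> s <= t ->
  (1 - e) * (t - s) <= h t - h s <= (1 + e) * (t - s).
Proof.
move=> [_ _ _ _ slope]; rewrite le_eqVlt => /predU1P[->|st].
  by rewrite !subrr !mulr0 lexx.
have := slope s t; rewrite gt_eqF// => /(_ isT).
rewrite ler_norml lerBrDl => /andP[]; rewrite ler_pdivlMr ?subr_gt0// => ->.
by rewrite lerBlDl ler_pdivrMr ?subr_gt0.
Qed.

Section Decoding.
Context {R : realType}.
Variables G L beta : R.
Hypotheses (L_gt0 : 0 < L) (beta_itv : 0 <= beta <= L) (G_ge : 100%:R * L <= G).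

(** The ratio 2 of the two stays exceeds the distortion between clocks with slopes in
    [19/20, 21/20]; since [100 * L <= G], loops are too short to blur this. *)
Definition gap (b : bool) : R := if b then G + G else G.

Lemma gap_bounds b : G <= gap b <= G + G.
Proof.
have := L_gt0; have := G_ge; rewrite /gap.
by case: b => ? ?; apply/andP; split; lra.
Qed.

Definition word_time (w : seq bool) : R := \sum_(b <- w) (gap b + L).

Lemma word_time_rcons w b : word_time (rcons w b) = word_time w + gap b + L.
Proof. by rewrite /word_time -cats1 big_cat/= big_seq1 addrA. Qed.

Lemma word_time_ge0 w : 0 <= word_time w.
Proof.
apply: sumr_ge0 => b _; have /andP[? ?] := gap_bounds b.
by have := L_gt0; have := G_ge; lra.
Qed.

Lemma word_time_le w : word_time w <= (G + G + L) *+ size w.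
Proof.
elim: w => [|b w IH]; first by rewrite /word_time big_nil.
rewrite /word_time big_cons -/(word_time w) mulrS lerD// lerD2r.
by case/andP: (gap_bounds b).
Qed.

(* Reparametrizations of ratio at most 1/20 lose synchronization over a whole
   word, but the visit [s] is pinned between two stays and restores it. *)
Lemma visit_time (h h' : R -> R) (b b' : bool) (S s : R) :
  Rep 20%:R^-1 h -> Rep 20%:R^-1 h' -> `|h S - h' S| <= L + L ->
  gap b <= gap b' -> h' s = h (S + gap b + beta) ->
  ~ (S <= s < S + gap b') ->
  ~ (S + gap b' + L <= s < S + gap b' + L + G) ->
  b = b' /\
  `|h (S + gap b' + L) - h' (S + gap b' + L)| <= L + L.
Proof.
move=> Rh Rh' + bb' hs out1 out2.
rewrite !ler_norml => /andP[sync1 sync2].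
have /andP[? ?] := gap_bounds b; have /andP[? ?] := gap_bounds b'.
have /andP[? ?] := beta_itv; have L0 := L_gt0; have G0 := G_ge.
have /andP[v1 v2] := @Rep_bounds _ _ h S (S + gap b + beta) Rh ltac:(lra).
have sS : S <= s.
  rewrite leNgt; apply/negP => sS.
  by have /andP[? ?] := @Rep_bounds _ _ h' s S Rh' (ltW sS); lra.
have s1 : S + gap b' <= s.
  by rewrite leNgt; apply/negP => ?; apply: out1; apply/andP.
have := @Rep_bounds _ _ h' S s Rh' sS; rewrite hs => /andP[s2 s3].
(* Beyond the second window [h'] would have run at least [G] longer than [h] did up to the visit,
   more than slopes and the error [L + L] allow. *)
have s4 : s < S + gap b' + L.
  rewrite ltNge; apply/negP => s4; apply: out2; apply/andP; split => //.
  by lra.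
(* A short [b] against a long [b'] would force [h' s - h' S >= 19/20 * (G + G)], beyond
   [21/20 * (G + L)] plus the error [L + L]. *)
have eb : b = b'.
  move: bb' s1 s2 v2; set v := h (_ + beta); rewrite /gap.
  by case: (b); case: (b') => // ? ? ? ?; exfalso; lra.
split=> //; subst b'.
(* Both clocks show the same value at the visit and have at most [L] left to the end of the loop, so
   the old error is forgotten. *)
have /andP[? ?] := @Rep_bounds _ _ h (S + gap b + beta) (S + gap b + L) Rh ltac:(lra).
have /andP[? ?] := @Rep_bounds _ _ h' s (S + gap b + L) Rh' ltac:(lra).
by apply/andP; split; lra.
Qed.

(* [Q] marks the visits to the avoided point, [K] the stays near the orbit that
   avoids it; the symbol [b] contributes a stay of length [gap b] followed by a
   loop of length [L], which makes its visit after time [beta]. *)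
Definition itinerary (h : R -> R) (Q K : set R) (w : seq bool) : Prop :=
  (forall w1 b w2, w = w1 ++ b :: w2 ->
    Q (h (word_time w1 + gap b + beta))) /\
  (forall w1 w2 s, w = w1 ++ w2 ->
    word_time w1 <= s < word_time w1 + gap (head false w2) -> K (h s)).

Lemma Rep_surjective (e : R) (h : R -> R) (v : R) :
  Rep e h -> exists s, h s = v.
Proof. by move=> [_ _ [g [_ gK _]] _ _]; exists (g v). Qed.

(** A visit of one word cannot share its flow time with a stay of the other; this excludes both
    windows in [visit_time]. *)
Lemma itinerary_next (h h' : R -> R) (Q K Q' K' : set R) (w1 : seq bool)
    (b b' : bool) (w2 w2' : seq bool) :
  Rep 20%:R^-1 h -> Rep 20%:R^-1 h' ->
  itinerary h Q K (w1 ++ b :: w2) -> itinerary h' Q' K' (w1 ++ b' :: w2') ->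
  `|h (word_time w1) - h' (word_time w1)| <= L + L ->
  gap b <= gap b' ->
  ~ (Q `&` K') (h (word_time w1 + gap b + beta)) ->
  b = b' /\
  `|h (word_time (rcons w1 b')) - h' (word_time (rcons w1 b'))| <= L + L.
Proof.
move=> Rh Rh' [visit _] [_ away] sync bb' noQK.
have [s hs] := Rep_surjective (h (word_time w1 + gap b + beta)) Rh'.
have Qs := visit _ _ _ erefl.
rewrite word_time_rcons; apply: (visit_time Rh Rh' sync bb' hs) => sitv;
  apply: noQK; split => //; rewrite -hs.
  exact: (away w1 (b' :: w2') s erefl sitv).
(* The second window lies in the stay after the loop, of length at least [G]; if [w2'] is empty, the
   default [false] makes it the trailing stay. *)
apply: (away (rcons w1 b') w2'); first by rewrite cat_rcons.
rewrite word_time_rcons; move/andP: sitv => [-> /lt_le_trans->]//.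
by rewrite lerD2l; case/andP: (gap_bounds (head false w2')).
Qed.

(** Induction along the common prefix, with synchronization up to [L + L] as invariant. As slopes
    are at most 21/20, [T] bounds the flow time of every visit. *)
Lemma itinerary_inj (h h' : R -> R) (Q K Q' K' : set R) (w w' : seq bool)
    (T : R) :
  Rep 20%:R^-1 h -> Rep 20%:R^-1 h' ->
  itinerary h Q K w -> itinerary h' Q' K' w' ->
  size w = size w' -> 21%:R / 20%:R * word_time w <= T ->
  21%:R / 20%:R * word_time w' <= T ->
  (forall v, 0 <= v <= T -> ~ (Q `&` K') v /\ ~ (Q' `&` K) v) ->
  w = w'.
Proof.
move=> Rh Rh' iw iw' sz wT wT' noQK.
have h0 : h 0 = 0 by case: Rh.
have h'0 : h' 0 = 0 by case: Rh'.
have bound g w1 b w2 : Rep 20%:R^-1 g ->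
    21%:R / 20%:R * word_time (w1 ++ b :: w2) <= T ->
    0 <= g (word_time w1 + gap b + beta) <= T.
  move=> Rg; rewrite -cat_rcons /word_time big_cat/=.
  rewrite -2!/(word_time _) word_time_rcons.
  have := word_time_ge0 w1; have := word_time_ge0 w2; have /andP[? ?] := beta_itv.
  have L0 := L_gt0; have G0 := G_ge; have /andP[? ?] := gap_bounds b.
  move=> ? ? ?; have g0 : g 0 = 0 by case: Rg.
  have /andP[] := @Rep_bounds _ _ g 0 (word_time w1 + gap b + beta) Rg ltac:(lra).
  by rewrite g0 !subr0 => ? ?; apply/andP; split; lra.
suff main w1 w2 w2' : w = w1 ++ w2 -> w' = w1 ++ w2' ->
    `|h (word_time w1) - h' (word_time w1)| <= L + L -> w2 = w2'.
  apply: (main [::]) => //; rewrite /word_time big_nil h0 h'0 subrr normr0.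
  by rewrite addr_ge0// ltW.
elim: w2 w1 w2' => [|b w2 IH] w1 [|b' w2'] ew ew' sync //;
  try by move: sz; rewrite ew ew' !size_cat/= => /addnI.
move: iw iw' wT wT'; rewrite ew ew' => iw iw' wT wT'.
have [bb' sync'] : b = b' /\
    `|h (word_time (rcons w1 b)) - h' (word_time (rcons w1 b))| <= L + L.
  (* The word with the shorter gap provides the visit, so disjointness is used in both
     directions. *)
  have [bb'|b'b] := leP (gap b) (gap b').
    have [] := itinerary_next Rh Rh' iw iw' sync bb'.
      exact: (noQK _ (bound _ _ _ _ Rh wT)).1.
    by move=> <-.
  rewrite distrC in sync.
  have [] := itinerary_next Rh' Rh iw' iw sync (ltW b'b).
    exact: (noQK _ (bound _ _ _ _ Rh' wT')).2.
  by move=> ->; rewrite distrC.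
subst b'; congr cons; apply: (IH (rcons w1 b)) => //; by rewrite cat_rcons.
Qed.

End Decoding.

(** * Compactness and recurrence *)

Section Topology.
Context {R : realType} {X : metricType R} (phi : R -> X -> X).

(** This extends closeness at integer times to all times; [eta] comes from compactness of the
    product of [X] and [[0, 1]]. *)
Lemma flow_unif_continuous (r : R) : compact [set: X] ->
  continuous_flow phi -> 0 < r ->
  exists2 eta : R, 0 < eta & forall x y s, 0 <= s <= 1 ->
    mdist x y <= eta -> mdist (phi s x) (phi s y) <= r.
Proof.
move=> cX [cphi _ _] r0.
have cXI : compact (@setX X R [set: X] `[0, 1]).
  by apply: compact_setX => //; exact: segment_compact.
have /compact_near_coveringP/(_ R (0^'+)
  (fun eta p => forall y, mdist p.1 y <= eta ->
     mdist (phi p.2 p.1) (phi p.2 y) <= r)) := cXI.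
case.
  move=> [x s] _.
  have : nbhs (phi s x) (ball (phi s x) (r / 2)).
    by apply: nbhsx_ballx; rewrite divr_gt0.
  move=> /(cphi (s, x))[[A B] /= [As Bx] AB].
  move: Bx => /nbhs_ballP[d /= d0 dB].
  exists (ball x (d / 2) `*` A, [set e : R | e < d / 2]).
    split; first exists (ball x (d / 2), A) => //=.
      by split=> //; apply: nbhsx_ballx; rewrite divr_gt0.
    by apply: nbhs_right_lt; rewrite divr_gt0.
  move=> [[x' s'] eta] /= [[xx' As'] /= etad] y xy.
  have Bx' : B x'.
    by apply: dB; apply: le_ball xx'; rewrite ler_pdivrMr// ler_pMr// ler1n.
  have By : B y.
    apply: dB; rewrite (splitr d); apply: ball_triangle xx' _.
    by rewrite ballEmdist/= (le_lt_trans xy).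
  have := AB (s', x') (conj As' Bx'); have := AB (s', y) (conj As' By).
  rewrite /= !ballEmdist/= => h1 h2.
  apply: le_trans (metric_triangle _ (phi s x) _) _.
  by rewrite metric_sym (splitr r) lerD// ltW.
move=> e /= e0 He.
exists (e / 2); first by rewrite divr_gt0.
move=> x y s s01 xy.
apply: (He (e / 2) _ _ (x, s)) => //=.
- by rewrite sub0r normrN gtr0_norm ?divr_gt0// ltr_pdivrMr// ltr_pMr// ltr1n.
- by rewrite divr_gt0.
Qed.

(** The points [phi n x] at integer times cluster at some [c]; two of them within [d / 2] of [c]
    give the return. *)
Lemma almost_periodic_point (x : X) (d : R) : compact [set: X] ->
  continuous_flow phi -> 0 < d ->
  exists s a : R, 1 <= a /\ mdist (phi a (phi s x)) (phi s x) <= d.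
Proof.
move=> cX [_ _ phiD] d0.
have [c [_ cc]] := cX ((fun n => phi n%:R x) @ \oo)%classic _ filterT.
have d20 : 0 < d / 2 by rewrite divr_gt0.
have recur m : exists2 n, (m < n)%N & mdist c (phi n%:R x) < d / 2.
  pose A := [set phi n%:R x | n in [set n | (m < n)%N]].
  have FA : ((fun n => phi n%:R x) @ \oo)%classic A.
    by exists m.+1 => // n /= mn; exists n.
  have [y [[n /= mn <-]]] := cc A (ball c (d / 2)) FA (nbhsx_ballx _ _ d20).
  by rewrite ballEmdist; exists n.
have [m _ cm] := recur 0%N; have [n mn cn] := recur m.
exists m%:R, (n - m)%:R; split; first by rewrite ler1n subn_gt0.
rewrite -phiD -natrD subnK ?(ltnW mn)//.
apply: le_trans (metric_triangle _ c _) _.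
by rewrite (splitr d) metric_sym lerD ?ltW// metric_sym.
Qed.

Lemma closure_dist (A : set X) (q : X) : ~ closure A q ->
  exists2 r : R, 0 < r & forall z, A z -> r <= mdist q z.
Proof.
move=> /existsNP[B]/not_implyP[/nbhs_ballP[r /= r0 rB] AB].
exists r => // z Az; rewrite leNgt; apply/negP => qz.
by apply: AB; exists z; split => //; apply: rB; rewrite ballEmdist.
Qed.

End Topology.

(** * Entropy from coded words *)

Section Entropy.
Context {R : realType} {X : metricType R}.

(** The [2 ^ n] separated points at time [M * n.+1] give a growth rate of at least
    [ln 2 / (M * 2)]. *)
Lemma entropy_gt0 (f : X -> X) (e : R) (M : nat)
    (y : forall n, n.-tuple bool -> X) : 0 < e -> (0 < M)%N ->
  (forall n (w w' : n.-tuple bool), w != w' ->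
    exists2 k, (k < M * n.+1)%N &
      e < mdist (iter k f (y n w)) (iter k f (y n w'))) ->
  (0 < topological_entropy f)%E.
Proof.
move=> e0 M0 sep.
have ln20 : (0 : R) < ln 2 by rewrite ln_gt0// ltr1n.
pose c : R := ln 2 / (M%:R * 2).
have c0 : 0 < c by rewrite divr_gt0// mulr_gt0// ltr0n.
have count n : ((2 ^+ n)%:E <= separated_number f (M * n.+1) e)%E.
  apply: ereal_sup_ubound => /=.
  exists [fset y n w | w in {: n.-tuple bool}]%fset.
    move=> _ _ /imfsetP[w _ ->] /imfsetP[w' _ ->] ww'.
    by apply: sep; apply: contra_notN ww' => /eqP ->.
  rewrite card_imfset/=; last first.
    move=> w w' yww'; apply/eqP; apply/negP => /negP /sep[k _].
    by rewrite yww' mdistxx ltNge ltW.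
  by rewrite -cardT card_tuple card_bool natrX.
have scale : (c%:E <= entropy_at_scale f e)%E.
  apply: le_ereal_inf_tmp => _ [V [n0 _ n0V] <-].
  (* Taking [n] positive makes [n / n.+1] at least 1/2, whence the factor 2 in [c]; [N] also lies in
     the tail beyond [n0]. *)
  pose n := n0.+1; pose N := (M * n.+1)%N.
  apply: le_trans (ereal_sup_ubound _); last first.
    exists N => //; apply: n0V => /=.
    by rewrite (leq_trans _ (leq_pmull _ _))// ltnW.
  have NR : (N%:R : R) = M%:R * n.+1%:R by rewrite natrM.
  have N0 : (0 : R) < N%:R by rewrite NR mulr_gt0// ltr0n.
  apply: (@le_trans _ _ ((N%:R^-1)%:E * lne ((2 ^+ n)%:E))%E).
    rewrite lne_EFin ?exprn_gt0// -EFinM lee_fin lnXn// /c NR.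
    have M1 : (M%:R : R) != 0 by rewrite pnatr_eq0 -lt0n.
    rewrite ler_pdivlMl ?mulr_gt0 ?ltr0n// -(mulr_natr (ln 2)).
    have -> : M%:R * n.+1%:R * (ln 2 / (M%:R * 2)) = ln 2 * (n.+1%:R / 2) :> R.
      by rewrite invfM mulrCA mulrACA divff// mul1r.
    rewrite ler_wpM2l ?(ltW ln20)// ler_pdivrMr// -natrM ler_nat /n.
    by rewrite muln2 -addnn addnS addSn !ltnS leq_addr.
  apply: lee_wpmul2l; first by rewrite lee_fin invr_ge0 ltW.
  rewrite lee_lne ?in_itv/= ?leey ?andbT ?lee_fin ?exprn_ge0//.
  by apply: le_trans (count n); rewrite lee_fin exprn_ge0.
apply: lt_le_trans (_ : (c%:E <= _)%E); first by rewrite lte_fin.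
apply: lime_ge; first exact: is_cvg_entropy_at_scale.
near=> e'; apply: le_trans scale _.
apply: entropy_at_scale_nonincreasing.
near: e'; exact: nbhs_right_le.
Unshelve. all: by end_near. Qed.

End Entropy.

(** * Loops, codes and their tracing *)

Section PseudoOrbits.
Context {R : realType} {X : metricType R} (phi : R -> X -> X).
Implicit Types (u v : X * R) (s : seq (X * R)).

Definition jump (d : R) u v : bool := mdist (phi u.2 u.1) v.1 <= d.

Definition admissible (L : set X) : set (X * R) :=
  [set u | L u.1 /\ 1 <= u.2].

Definition duration s : R := \sum_(u <- s) u.2.

Lemma duration_cat s1 s2 : duration (s1 ++ s2) = duration s1 + duration s2.
Proof. by rewrite /duration big_cat. Qed.

Lemma duration_ge0 (L : set X) s :
  (forall u, u \in s -> admissible L u) -> 0 <= duration s.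
Proof.
move=> sL; rewrite /duration big_seq; apply: sumr_ge0 => u /sL[_].
exact: le_trans.
Qed.

(** The default [x0] is also the endpoint of the path and is related to itself, so the index may run
    past the end. *)
Lemma path_nth_rcons (T : Type) (e : rel T) (x0 y : T) (s : seq T) (n : nat) :
  e x0 x0 -> path e y (rcons s x0) ->
  e (nth x0 (y :: s) n) (nth x0 (y :: s) n.+1).
Proof.
move=> exx; elim: s y n => [|z s IH] y [|n]/=.
- by rewrite andbT.
- by move=> _; rewrite !nth_nil.
- by case/andP.
- by case/andP => _; exact: IH.
Qed.

(** Since [jump] reads only the point of its target, a return to [u] is also a jump into any loop
    whose first entry has the point of [u]; this makes loops concatenable. *)
Definition loop (d : R) u s : bool :=
  path (jump d) u (rcons s u) && ((head u s).1 == u.1).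

Lemma loop_cat d u s1 s2 :
  loop d u s1 -> loop d u s2 -> loop d u (s1 ++ s2).
Proof.
case: s1 => [//|v1 s1]; case: s2 => [|v2 s2]; first by rewrite cats0.
move=> /andP[/= /andP[uv1 p1] v1u] /andP[/= /andP[_ p2] /eqP v2u].
rewrite /loop/= v1u uv1 andbT rcons_cat cat_path/= p2 andbT.
by move: p1; rewrite rcons_path /jump v2u.
Qed.

Lemma loop_nseq d u n : jump d u u -> loop d u (nseq n u).
Proof.
move=> uu; elim: n => [|n IH]; first by rewrite /loop/= uu/=.
by apply: (@loop_cat d u [:: u]) => //; rewrite /loop/= uu/=.
Qed.

(** The duration [b] of the last entry stays free, so that any entry at [y] can continue the
    segment. *)
Lemma chain_segments (L : set X) (x y : X) (d : R) :
  chain_transitive phi L -> L x -> L y -> 0 < d ->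
  exists a : R, exists s,
    (forall u, u \in (x, a) :: s -> admissible L u) /\
    forall b, path (jump d) (x, a) (rcons s (y, b)).
Proof.
move=> cL Lx Ly d0.
have [N [z [t [N1 [t1 zt] Lz z0 zN]]]] := cL x y Lx Ly d d0.
case: N N1 t1 zt Lz zN => [//|N] _ t1 zt Lz zN.
have IN (i : nat) (n : nat) : (i <= n)%N -> (i%:Z \in `[0, n%:Z]).
  by move=> ?; rewrite in_itv/= lez_nat.
suff [s [sL sP]] : exists s,
    (forall u, u \in (x, t 0) :: s -> admissible L u) /\
    forall b, path (jump d) (x, t 0) (rcons s (z N.+1%:Z, b)).
  by exists (t 0), s; rewrite -zN.
clear zN; elim: N t1 zt Lz => [|N IH] t1 zt Lz.
  exists [::]; split=> [u|b] /=.
    by rewrite mem_seq1 => /eqP->; split => //=; apply/t1/(IN 0%N).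
  by rewrite andbT /jump/= -z0; exact: (zt 0 (IN 0%N _ _) (IN 1%N _ _)).
have IN' i : i \in `[0, N.+1%:Z] -> i \in `[0, N.+2%:Z].
  rewrite !in_itv/= => /andP[-> /le_trans->]//; by rewrite lez_nat.
have [s [sL sP]] : exists s,
    (forall u, u \in (x, t 0) :: s -> admissible L u) /\
    forall b, path (jump d) (x, t 0) (rcons s (z N.+1%:Z, b)).
  by apply: IH => i *; [apply: t1|apply: zt|apply: Lz]; exact: IN'.
exists (rcons s (z N.+1%:Z, t N.+1%:Z)); split=> [u|b].
  rewrite -rcons_cons mem_rcons inE => /predU1P[->|/sL//].
  by split=> /=; [apply: Lz|apply: t1]; exact: IN.
rewrite rcons_path sP last_rcons/= /jump/=.
have := zt N.+1%:Z (IN N.+1 _ (leqnSn _)).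
by rewrite -PoszD addn1; apply; exact: IN.
Qed.

Definition traces (e : R) s (h : R -> R) (y : X) : Prop :=
  forall s1 u s2 (r : R), s = s1 ++ u :: s2 ->
    0 <= r <= u.2 -> mdist (phi r u.1) (phi (h (duration s1 + r)) y) <= e.

(** Repeating [u0] forever before and after the loop gives a bi-infinite pseudo-orbit, supported in
    [L] by invariance. *)
Lemma traced_segments (L : set X) (e : R) :
  local_standard_shadowing phi L -> invariant_set phi L -> 0 < e ->
  exists2 d : R, 0 < d & forall (u0 : X * R) s,
    (forall u, u \in u0 :: s -> admissible L u) ->
    jump d u0 u0 -> loop d u0 s ->
    exists y h, Rep e h /\ traces e s h y.
Proof.
move=> sh invL e0; have [U [d [LU d0 tr]]] := sh e 1 e0 ltr01.
exists d => // u0 s sL u00 /andP[us _].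
have nthL n : admissible L (nth u0 (u0 :: s) n).
  have [ns|sn] := ltnP n (size (u0 :: s)); first exact/sL/mem_nth.
  by rewrite nth_default//; apply: sL; rewrite mem_head.
(* The loop starts at index 0, hence at time 0; the default of [nth] supplies the copies of [u0]
   after it. *)
pose g (i : int) := if i is Posz n then nth u0 s n else u0.
have gL i : admissible L (g i).
  by case: i => n; [exact: (nthL n.+1)|exact: (nthL 0%N)].
have [| |y [h Rh hy]] := tr (fun i => (g i).1) (fun i => (g i).2).
- split=> [i _|i _ _]; first by case: (gL i).
  case: i => [n|[|n]].
  + by rewrite -PoszD addn1; exact: (path_nth_rcons n.+1 u00 us).
  + by rewrite (_ : Negz 0 + 1 = 0)//; exact: (path_nth_rcons 0 u00 us).
  + by rewrite (_ : Negz n.+1 + 1 = Negz n)// !NegzE -[n.+2]addn1 PoszD opprD addrNK.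
- move=> _ [i _ [r _ <-]]; have [Lg _] := gL i.
  have /LU : L (phi r (g i).1) by rewrite -(invL r); exists (g i).1.
  exact: nbhs_singleton.
exists y, h; split=> // s1 u s2 r es /andP[r0 ru].
have gn : g (size s1) = u by rewrite /g es nth_cat ltnn subnn.
have st : switching_time (fun i => (g i).2) (size s1) = duration s1.
  rewrite /= /duration (big_nth u0); apply: eq_big_nat => i /andP[_ ilt].
  by rewrite /g es nth_cat ilt.
have st1 : switching_time (fun i => (g i).2) ((size s1)%:Z + 1) =
    duration s1 + u.2.
  rewrite -PoszD addn1 -st /= big_nat_recr//=; congr (_ + _).
  by rewrite es nth_cat ltnn subnn.
have := hy (size s1) (duration s1 + r).
rewrite st st1 gn (addrC (duration s1)) addrK; apply.
by rewrite lerDr r0 addrC lerD2l.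
Qed.

Lemma duration_nseq n u : duration (nseq n u) = n%:R * u.2.
Proof. by rewrite /duration big_nseq iter_addr_0 mulr_natl. Qed.

Lemma traces_nseq e s h y s1 n u s2 (t : R) : traces e s h y ->
  s = s1 ++ nseq n u ++ s2 ->
  duration s1 <= t < duration s1 + n%:R * u.2 ->
  exists r, mdist (phi r u.1) (phi (h t) y) <= e.
Proof.
move=> tr; elim: n s1 => [|n IH] s1 es /andP[s1t ts1].
  by have := le_lt_trans s1t ts1; rewrite mul0r addr0 ltxx.
have [tu|ut] := leP t (duration s1 + u.2).
  exists (t - duration s1); have := tr s1 u _ (t - duration s1) es.
  by rewrite (addrC (duration s1)) subrK; apply; rewrite subr_ge0 s1t lerBlDl.
apply: (IH (rcons s1 u)); first by rewrite cat_rcons.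
rewrite -cats1 duration_cat /(duration [:: u]) big_seq1 (ltW ut)/=.
by move: ts1; rewrite -natr1 mulrDl mul1r addrA addrAC.
Qed.

Definition block u s (k : nat) (b : bool) : seq (X * R) :=
  nseq (if b then k + k else k) u ++ s.

Definition blocks u s k (w : seq bool) := flatten [seq block u s k b | b <- w].

(* The trailing copies of [u] make every position of the code start with a
   stay of at least [k] copies. *)
Definition code u s k (w : seq bool) := blocks u s k w ++ nseq k u.

Lemma duration_blocks u s k w :
  duration (blocks u s k w) = word_time (k%:R * u.2) (duration s) w.
Proof.
elim: w => [|b w IH]; first by rewrite /word_time /duration !big_nil.
rewrite /word_time big_cons -/(word_time _ _ w) -IH /blocks/= /block.
rewrite !duration_cat duration_nseq /gap; case: b => //.
by rewrite natrD mulrDl.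
Qed.

Lemma loop_code d u s k w :
  jump d u u -> loop d u s -> loop d u (code u s k w).
Proof.
move=> uu us; apply: loop_cat; last exact: loop_nseq.
elim: w => [|b w IH]; first exact: (@loop_nseq d u 0).
by apply: loop_cat => //; apply: loop_cat => //; exact: loop_nseq.
Qed.

Lemma code_admissible L u s k w : (forall v, v \in u :: s -> admissible L v) ->
  forall v, v \in u :: code u s k w -> admissible L v.
Proof.
move=> sL v vc; apply: sL; move: vc; rewrite !inE => /orP[->//|].
rewrite mem_cat mem_nseq => /orP[|/andP[_ ->]//].
move=> /flattenP[_ /mapP[b _ ->]]; rewrite mem_cat mem_nseq.
by move=> /orP[/andP[_ ->]//|->]; rewrite orbT.
Qed.

Lemma traces_code e u s s1 v s2 k w h y :
  s = s1 ++ v :: s2 -> 0 <= v.2 -> phi 0 v.1 = v.1 ->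
  traces e (code u s k w) h y ->
  itinerary (k%:R * u.2) (duration s) (duration s1) h
    [set t | mdist v.1 (phi t y) <= e]
    [set t | exists r, mdist (phi r u.1) (phi t y) <= e] w.
Proof.
move=> es v0 phi0 tr; split=> [w1 b w2 ew|w1 w2 t ew tw].
  have := tr (blocks u s k w1 ++ nseq (if b then k + k else k) u ++ s1) v
    (s2 ++ blocks u s k w2 ++ nseq k u) 0.
  rewrite phi0 addr0 !duration_cat duration_blocks duration_nseq.
  rewrite lexx v0 addrA => /(_ _ isT); rewrite /gap.
  have -> : (if b then k%:R * u.2 + k%:R * u.2 else k%:R * u.2) =
     (if b then (k + k)%N else k)%:R * u.2 by case: (b); rewrite // natrD mulrDl.
  apply; rewrite /code ew /blocks map_cat flatten_cat/= /block.
  rewrite -!catA; congr (_ ++ _); congr (_ ++ _).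
  by rewrite [X in X ++ _]es -!catA.
(* When [w2] is empty, the stay is the trailing [nseq k u], in accordance with [head false]. *)
apply: (traces_nseq (s1 := blocks u s k w1)
  (n := if head false w2 then k + k else k)
  (s2 := if w2 is b :: w3 then s ++ blocks u s k w3 ++ nseq k u else [::]) tr).
  rewrite /code ew /blocks map_cat flatten_cat -catA; congr cat.
  by case: w2 {ew tw} => [|b w2]/=; [rewrite cats0|rewrite /block -!catA].
rewrite duration_blocks; move: tw; rewrite /gap.
by case: (head false w2) => //; rewrite natrD mulrDl.
Qed.

End PseudoOrbits.

(** * Positive entropy from an avoided point *)

Section Flow.
Context {R : realType} {X : metricType R} (phi : R -> X -> X).

Lemma iter_time_one k x : continuous_flow phi -> iter k (phi 1) x = phi k%:R x.
Proof.
move=> [_ phi0 phiD]; elim: k => [|k IH]/=; first by rewrite phi0.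
by rewrite IH -phiD nat1r.
Qed.

Lemma separated_at_integer_time (eta r : R) (N : nat) (y y' : X) :
  continuous_flow phi ->
  (forall x x' s, 0 <= s <= 1 -> mdist x x' <= eta ->
    mdist (phi s x) (phi s x') <= r) ->
  (forall k, (k < N)%N ->
    mdist (iter k (phi 1) y) (iter k (phi 1) y') <= eta) ->
  forall v, 0 <= v < N%:R -> mdist (phi v y) (phi v y') <= r.
Proof.
move=> flow unif close v /andP[v0 vN].
have /andP[kv vk] := truncn_itv v0; set k := Num.trunc v in kv vk.
have [_ _ phiD] := flow.
rewrite -(subrK k%:R v) !(phiD (v - _)) -!(iter_time_one k)//; apply: unif.
  by rewrite subr_ge0 kv/= lerBlDl natr1 ltW.
by apply: close; rewrite -(ltr_nat R) (le_lt_trans kv).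
Qed.

Lemma entropy_of_avoided_point (L : set X) (x q : X) (r : R) :
  compact [set: X] -> continuous_flow phi -> invariant_set phi L ->
  chain_transitive phi L -> local_standard_shadowing phi L ->
  L x -> L q -> 0 < r -> (forall t, r <= mdist q (phi t x)) ->
  (0 < flow_entropy phi)%E.
Proof.
move=> cX flow invL chainL shL Lx Lq r0 far.
have [_ phi0 phiD] := flow.
(* Three distances of at most [r / 4] will connect [q] to the orbit of [x], contradicting [far]. *)
pose r' := r / 4; have r'0 : 0 < r' by rewrite divr_gt0.
pose e := Num.min r' 20^-1.
have e0 : 0 < e by rewrite lt_min r'0 invr_gt0 ltr0n.
have er : e <= r' by rewrite ge_min lexx.
have e20 : e <= 20^-1 by rewrite ge_min lexx orbT.
have [d d0 tr] := traced_segments shL invL e0.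
have [eta eta0 unif] := flow_unif_continuous cX flow r'0.
have [m [a [a1 pa]]] := almost_periodic_point x cX flow d0.
pose p := phi m x; pose u := (p, a).
have Lp : L p by rewrite -(invL m); exists x.
have [a1' [s1 [s1L s1P]]] := chain_segments chainL Lp Lq d0.
have [a2 [s2 [s2L s2P]]] := chain_segments chainL Lq Lp d0.
(* The first entry is at [p], so the almost return [pa] leads into this loop through [q]. *)
pose s := ((p, a1') :: s1) ++ (q, a2) :: s2.
have uu : jump phi d u u by [].
have us : loop phi d u s.
  rewrite /loop /s /= eqxx andbT rcons_cat/= {1}/jump/= pa/=.
  have := s1P a2; rewrite -cats1 !cat_path/= => /and3P[-> -> _]/=.
  exact: s2P.
have sL v : v \in u :: s -> admissible L v.
  by rewrite inE mem_cat => /predU1P[->//|/orP[/s1L|/s2L]].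
have [a2_ge s2_ge] : 1 <= a2 /\ 0 <= duration s2.
  split; first by case: (s2L (q, a2) (mem_head _ _)).
  by apply: (duration_ge0 (L := L)) => v vs; apply: s2L; rewrite inE vs orbT.
have s1_ge : 0 <= duration ((p, a1') :: s1) by exact: duration_ge0 s1L.
have ds : duration s = duration ((p, a1') :: s1) + a2 + duration s2.
  by rewrite duration_cat {2}/duration big_cons addrA.
have s0 : 0 < duration s by lra.
have s1s : 0 <= duration ((p, a1') :: s1) <= duration s by apply/andP; split; lra.
pose k := Num.bound (100%:R * duration s); pose G := k%:R * a.
have kG : 100%:R * duration s <= G.
  apply: ltW; apply: (lt_le_trans (unstable.ltr_bound _)).
  by rewrite ler_peMr.
(* The most flow time one symbol can take: a long stay and the loop, at the largest slope. *)
pose T := 21%:R / 20%:R * (G + G + duration s).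
pose M := Num.bound T.
have TM : T < M%:R := unstable.ltr_bound _.
have M0 : (0 < M)%N.
  by rewrite -(ltr_nat R); apply: le_lt_trans TM; rewrite /T; lra.
have codeP w : exists y h, Rep 20^-1 h /\ itinerary G (duration s)
    (duration ((p, a1') :: s1)) h [set t | mdist q (phi t y) <= r']
    [set t | exists t', mdist (phi t' x) (phi t y) <= r'] w.
  have [y [h [Rh hy]]] :=
    tr u (code u s k w) (code_admissible sL) uu (loop_code k w uu us).
  exists y, h; split.
    by case: Rh => ? ? ? ? slope; split=> // ? ? /slope/le_trans->.
  have [] := @traces_code _ _ phi e u s _ (q, a2) s2 k w h y erefl _ _ hy => //=.
    exact: le_trans a2_ge.
  move=> visit away; split=> [w1 b w2 ew|w1 w2 t ew tw].
    exact: le_trans (visit _ _ _ ew) er.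
  (* Stays follow the orbit of [p = phi m x], hence the shift by [m]. *)
  have [t' tt'] := away _ _ _ ew tw; exists (t' + m).
  by rewrite phiD (le_trans tt').
have [y codey] := choice codeP.
apply: (entropy_gt0 (y := fun n (w : n.-tuple bool) => y w) eta0 M0).
move=> n w w' ww'.
(* Without separation the two points stay [r']-close throughout the coded time, so no visit of one
   meets a stay of the other and decoding gives [w = w']. *)
apply: contrapT => /forall2NP close.
have {}close k0 : (k0 < M * n.+1)%N ->
    mdist (iter k0 (phi 1) (y w)) (iter k0 (phi 1) (y w')) <= eta.
  by move=> kM; case: (close k0) => [/(_ kM)//|/negP]; rewrite -leNgt.
have {}close := separated_at_integer_time flow unif close.
have [h [Rh hw]] := codey w; have [h' [Rh' hw']] := codey w'.
have Tn (w0 : n.-tuple bool) :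
    21%:R / 20%:R * word_time G (duration s) w0 <= T *+ n.
  rewrite /T -mulrnAr ler_wpM2l ?divr_ge0//.
  by have := word_time_le s0 kG w0; rewrite size_tuple.
move/negP: ww'; apply; apply/eqP/val_inj.
apply: (itinerary_inj s0 s1s kG Rh Rh' hw hw' _ (Tn w) (Tn w')).
  by rewrite !size_tuple.
move=> v /andP[v0 vT].
have {}close : mdist (phi v (y w)) (phi v (y w')) <= r'.
  apply: close; rewrite v0 (le_lt_trans vT)// natrM mulr_natr.
  by rewrite mulrSr (@le_lt_trans _ _ (M%:R *+ n)) ?ltrDl ?ltr0n// lerMn2r ltW ?orbT.
have contra z z' : mdist z z' <= r' -> ~ (mdist q z <= r' /\
    exists t, mdist (phi t x) z' <= r').
  move=> zz' [qz [t tz']]; have := far t; apply/negP; rewrite -ltNge.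
  have := metric_triangle q z (phi t x); have := metric_triangle z z' (phi t x).
  by rewrite (metric_sym z' (phi t x)); rewrite /r' in qz zz' tz'; lra.
split; apply: contra => //; by rewrite metric_sym.
Qed.

End Flow.

(** * Reduction to an orbit avoiding a point *)

Unset Implicit Arguments.

Theorem theorem2 (R : realType) (X : metricType R) (phi : R -> X -> X)
    (Lambda : set X)
    (X_compact : compact [set: X])
    (phi_flow : continuous_flow phi)
    (Lambda_compact : compact Lambda)
    (Lambda_invariant : invariant_set phi Lambda)
    (Lambda_nontrivial : nontrivial phi Lambda)
    (Lambda_chain_transitive : chain_transitive phi Lambda)
    (Lambda_not_irreducible_almost_heteroclinic :
      ~ (almost_heteroclinic phi Lambda /\ irreducible phi Lambda))
    (Lambda_shadowing : local_standard_shadowing phi Lambda) :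
  (0 < flow_entropy phi)%E.
Proof.
suff [x [q [Lx Lq xq]]] : exists x q,
    [/\ Lambda x, Lambda q & ~ closure (flow_orbit phi x) q].
  have [r r0 far] := closure_dist xq.
  apply: (entropy_of_avoided_point X_compact phi_flow Lambda_invariant
    Lambda_chain_transitive Lambda_shadowing Lx Lq r0) => t.
  by apply: far; exists t.
have outside A : ~ (Lambda `<=` A) -> exists2 q, Lambda q & ~ A q.
  by move=> /existsNP[q /not_implyP[Lq Aq]]; exists q.
move/not_andP: Lambda_not_irreducible_almost_heteroclinic => [nah|/contrapT].
  (* If every orbit in [Lambda] were dense, the clause on non-dense orbits would hold vacuously. *)
  apply: contrapT => none; apply: nah; split=> // x Lx _ /outside[q Lq xq].
  by exfalso; apply: none; exists x, q.
move=> [K [[KL /outside[q Lq Kq]] [_ Ksing] [Kcompact Kinv _ _]]].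
move/existsNP: Ksing => [x /not_implyP[Kx _]].
exists x, q; split=> //; first exact: KL.
apply: contra_not Kq => xq.
apply: (compact_closed (@metric_hausdorff R X) Kcompact).
by apply: closureS xq => _ [t _ <-]; rewrite -(Kinv t); exists x.
Qed.
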